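(* Suppose that $Y$ is a closed convex set and that for every $x\in X$ the functions $f(x,\cdot)$ and $g_i(x,\cdot)$ ($i=1,\dots,l$) are convex on $Y$. Suppose moreover that $X$ is convex, that there is an open convex set $\mathcal{O}\supseteq X$ such that each $g_i$ is convex on $\mathcal{O}\times Y$ and $\mathcal{F}(x)\ne\emptyset$ for all $x\in\mathcal{O}$, and that $f$ is $\rho_f$-weakly convex, with $\rho_f>0$, on $D=\{(x,y)\in\mathcal{O}\times Y: g(x,y)\le 0\}$. If $\gamma\in(0,1/\rho_f)$, then $v_\gamma$ is Lipschitz continuous around every point of $X\times Y$ (i.e. every point of $X\times Y$ has a neighborhood on which $v_\gamma$ is Lipschitz continuous).
   Context: Here $X\subseteq\mathcal{O}\subseteq\mathbb{R}^n$, $Y\subseteq\mathbb{R}^m$, and $f$ and $g=(g_1,\dots,g_l)$ are real-valued, resp. $\mathbb{R}^l$-valued, on $\mathcal{O}\times Y$; inequalities between vectors are componentwise. For $x\in\mathcal{O}$ put $\mathcal{F}(x)=\{y\in Y: g(x,y)\le 0\}$. Standing assumption: for every $x\in X$ the set $S(x)=\operatorname{argmin}_{y\in\mathcal{F}(x)}f(x,y)$ is nonempty. For $\gamma>0$, $$v_\gamma(x,y)=\inf_{w\in\mathcal{F}(x)}\Big\{f(x,w)+\frac{1}{2\gamma}\|w-y\|^2\Big\},\qquad (x,y)\in \mathcal{O}\times\mathbb{R}^m .$$ A function $\phi$ is $\rho$-weakly convex ($\rho\ge 0$) on a convex set $U$ if $\phi(z)+\frac{\rho}{2}\|z\|^2$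 is convex on $U$. *)

(* Defs.v *)
From HB Require Import structures.
From mathcomp Require Import all_boot all_order all_algebra.
From mathcomp Require Import all_classical all_reals all_analysis.

Set Implicit Arguments.
Unset Strict Implicit.
Unset Printing Implicit Defensive.

Import Order.TTheory GRing.Theory Num.Theory.
Import numFieldNormedType.Exports.

Local Open Scope classical_set_scope.
Local Open Scope ring_scope.

(* The library norm on 'rV[R]_n and on products is the max norm, hence these
   explicit squared Euclidean norms. *)
Definition sqnorm (R : realType) (n : nat) (x : 'rV[R]_n) : R :=
  \sum_(i < n) x ord0 i ^+ 2.

Definition sqnorm_pair (R : realType) (n m : nat)
    (z : 'rV[R]_n * 'rV[R]_m) : R :=
  sqnorm z.1 + sqnorm z.2.

Definition nonpos_vec (R : realType) (l : nat) (u : 'rV[R]_l) : Prop :=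
  forall i : 'I_l, u ord0 i <= 0.

Definition feasible (R : realType) (n m l : nat) (Y : set 'rV[R]_m)
    (g : 'rV[R]_n * 'rV[R]_m -> 'rV[R]_l) (x : 'rV[R]_n) : set 'rV[R]_m :=
  [set y | Y y /\ nonpos_vec (g (x, y))].

Definition feasible_graph (R : realType) (n m l : nat)
    (Omega : set 'rV[R]_n) (Y : set 'rV[R]_m)
    (g : 'rV[R]_n * 'rV[R]_m -> 'rV[R]_l) : set ('rV[R]_n * 'rV[R]_m) :=
  [set z | (Omega `*` Y) z /\ nonpos_vec (g z)].

Definition argmin_set (R : realType) (T : Type) (A : set T) (phi : T -> R) :
    set T :=
  [set y | A y /\ forall w, A w -> phi y <= phi w].

Definition solution_set (R : realType) (n m l : nat) (Y : set 'rV[R]_m)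
    (f : 'rV[R]_n * 'rV[R]_m -> R) (g : 'rV[R]_n * 'rV[R]_m -> 'rV[R]_l)
    (x : 'rV[R]_n) : set 'rV[R]_m :=
  argmin_set (feasible Y g x) (fun y => f (x, y)).

(* An infimum in the extended reals: a priori it could be -oo. *)
Definition v_env (R : realType) (n m l : nat) (Y : set 'rV[R]_m)
    (f : 'rV[R]_n * 'rV[R]_m -> R) (g : 'rV[R]_n * 'rV[R]_m -> 'rV[R]_l)
    (gamma : R) (z : 'rV[R]_n * 'rV[R]_m) : \bar R :=
  ereal_inf [set (f (z.1, w) + (2 * gamma)^-1 * sqnorm (w - z.2))%:E
            | w in feasible Y g z.1].

Definition weakly_convex (R : realType) (n m : nat) (rho : R)
    (U : set ('rV[R]_n * 'rV[R]_m)) (phi : 'rV[R]_n * 'rV[R]_m -> R) : Prop :=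
  convex_function U (fun z => phi z + rho / 2 * sqnorm_pair z).

(* For an extended-real-valued function with domain W, being Lipschitz near p
   includes being finite there.  Lipschitz continuity is with respect to the
   library's max norm, which is equivalent to the Euclidean one. *)
Definition lipschitz_around (R : realType) (V : normedModType R)
    (W : set V) (v : V -> \bar R) (p : V) : Prop :=
  exists U : set V, [/\ nbhs p U, U `<=` W,
    (forall z, U z -> v z \is a fin_num) &
    [lipschitz (fine (v z) : R^o) | z in U]].

(* Main.v *)
(* Adding a suitable quadratic q(x, y) to f(x, w) + |w - y|^2 / (2 gamma) gives
   a jointly convex function of (x, w, y), because rho_f < 1 / gamma.  Hence
   v_gamma + q is a marginal of a convex function, so it is convex on
   Omega x R^m.  Over X the infimum is bounded below because f(x, .) attains its
   minimum, and by convexity it is then finite everywhere on the open set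
   Omega x R^m.  Finite convex functions on open sets of R^n x R^m are locally
   Lipschitz; this applies to both v_gamma + q and q. *)
Require Import Defs.
From HB Require Import structures.
From mathcomp Require Import all_boot all_order all_algebra.
From mathcomp Require Import all_classical all_reals all_analysis.
From mathcomp Require Import ring lra.

Set Implicit Arguments.
Unset Strict Implicit.
Unset Printing Implicit Defensive.

Import Order.TTheory GRing.Theory Num.Theory.
Import numFieldNormedType.Exports.

Local Open Scope classical_set_scope.
Local Open Scope ring_scope.

(** * Convexity with real weights *)

(** The weight, bundled with its bounds in [convex_set], becomes a plain real number, open to
    [field] and [lra]. *)
Lemma convex_setP (R : numDomainType) (V : lmodType R) (D : set V) :
  convex_set D <-> forall (t : R) (x y : V), 0 <= t -> t <= 1 -> D x -> D y ->
    D (t *: x + (1 - t) *: y).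
Proof.
split=> [cD t x y t0 t1 Dx Dy|cD x y t].
  have := cD x y (Itv01 t0 t1); rewrite !inE /=; exact.
rewrite !inE => Dx Dy; apply: cD => //; exact: ge0 || exact: le1.
Qed.

Lemma convex_functionP (R : numFieldType) (V : lmodType R) (D : set V)
    (h : V -> R) :
  convex_function D h <-> forall (t : R) (x y : V), 0 <= t -> t <= 1 ->
    D x -> D y -> h (t *: x + (1 - t) *: y) <= t * h x + (1 - t) * h y.
Proof.
split=> [ch t x y t0 t1 Dx Dy|ch t x y].
  by apply: (ch (Itv01 t0 t1)); rewrite inE.
rewrite !inE => Dx Dy; apply: ch => //; exact: ge0 || exact: le1.
Qed.

Lemma convex_functionS (R : numFieldType) (V : lmodType R) (A B : set V)
    (h : V -> R) :
  A `<=` B -> convex_function B h -> convex_function A h.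
Proof.
move=> AB /convex_functionP ch; apply/convex_functionP => t x y t0 t1 Ax Ay.
by apply: ch => //; exact: AB.
Qed.

(** * Local Lipschitz continuity of finite convex functions *)

Section ConvexLocallyLipschitz.
Variables (R : realType) (V : normedModType R).
Implicit Types (h : V -> R) (p d : V) (A B C : set V).

(** Restricting the displacements to [A] lets boundedness be built up from lines to sums of
    subspaces. *)
Definition bounded_above_near h p A :=
  exists e M : R, 0 < e /\ forall d, A d -> `|d| < e -> h (p + d) <= M.

(** Reflection in [p] turns the upper bound [M] into the lower bound [2 * h p - M], so [h]
    oscillates by at most [2 * (M - h p)] on the large ball. Prolonging a segment of the small ball
    by length [r] stays in the large one, and convexity along it bounds the slope by this
    oscillation over [r]. *)
Lemma convex_lipschitz_near h p r (M : R) : 0 < r ->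
  convex_function (ball p (r + r)) h ->
  (forall z, ball p (r + r) z -> h z <= M) ->
  exists k, forall y z, ball p r y -> ball p r z -> `|h y - h z| <= k * `|y - z|.
Proof.
move=> r0 /convex_functionP ch hM.
have lb z : ball p (r + r) z -> 2 * h p - M <= h z.
  move=> pz; set z' := p + (p - z).
  have pz' : ball p (r + r) z'.
    rewrite -ball_normE /ball_ /= /z' opprD addrA subrr sub0r normrN.
    by move: pz; rewrite -ball_normE.
  have := ch 2^-1 z z'; rewrite (_ : _ + _ = p); last first.
    rewrite (_ : 1 - 2^-1 = 2^-1 :> R); last by field.
    rewrite -scalerDr /z' addrCA (addrC z) subrK scalerDr -scalerDl.
    by rewrite (_ : 2^-1 + 2^-1 = 1 :> R) ?scale1r//; field.
  move=> H.
  have {}H : h p <= 2^-1 * h z + (1 - 2^-1) * h z' by apply: H => //; lra.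
  have := hM _ pz'; lra.
have rr z : ball p r z -> ball p (r + r) z.
  by apply: le_ball; rewrite lerDl ltW.
have main y z : ball p r y -> ball p r z ->
    h y - h z <= (2 * (M - h p) / r) * `|y - z|.
  move=> py pz; have [->|yz] := eqVneq y z; first by rewrite !subrr normr0 mulr0.
  set D := `|y - z|; have D0 : 0 < D by rewrite normr_gt0 subr_eq0.
  (* [u] lies at distance [r] beyond [y] on the ray from [z], so [y] divides the segment from [z] to
     [u] with weight [D / (r + D)] on [u]; this weight is at most [D / r]. *)
  set u := y + (r / D) *: (y - z).
  have rD : r + D != 0 by rewrite gt_eqF// addr_gt0.
  have D00 := lt0r_neq0 D0.
  have pu : ball p (r + r) u.
    move: py; rewrite -!ball_normE /ball_ /= => py.
    rewrite /u opprD addrA (le_lt_trans (ler_normB _ _))// ltr_leD//.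
    by rewrite normrZ (ger0_norm (ltW (divr_gt0 r0 D0))) divfK.
  have yE : y = (D / (r + D)) *: u + (1 - D / (r + D)) *: z.
    rewrite (_ : 1 - _ = r / (r + D)); last by field.
    rewrite /u scalerDr scalerA (_ : D / (r + D) * (r / D) = r / (r + D)); last first.
      by field; rewrite rD.
    rewrite -addrA -scalerDr subrK -scalerDl -mulrDl (addrC D) divff ?scale1r//.
  have t0 : 0 <= D / (r + D) by rewrite ltW ?divr_gt0 ?addr_gt0.
  have t1 : D / (r + D) <= 1 by rewrite ler_pdivrMr ?addr_gt0// mul1r lerDr ltW.
  have := ch _ _ _ t0 t1 pu (rr _ pz); rewrite -yE => hy.
  have h1 : h y - h z <= D / (r + D) * (2 * (M - h p)).
    have h2 : h u - h z <= 2 * (M - h p).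
      by have := hM _ pu; have := lb _ (rr _ pz); lra.
    have := ler_wpM2l t0 h2; lra.
  apply: (le_trans h1).
  have h3 : 0 <= 2 * (M - h p) by have := hM p (ballxx _ (addr_gt0 r0 r0)); lra.
  rewrite mulrC -mulrA ler_wpM2l// mulrC ler_wpM2r ?(ltW D0)//.
  by rewrite lef_pV2 ?posrE ?addr_gt0// lerDl ltW.
exists (2 * (M - h p) / r) => y z py pz.
rewrite ler_norml main// andbT lerNl opprB distrC; exact: main.
Qed.

(** On a segment centred at [p], convexity bounds [h] by its values at the two endpoints. *)
Lemma convex_bounded_above_line h p r v : 0 < r ->
  convex_function (ball p r) h ->
  bounded_above_near h p [set t *: v | t in [set: R]].
Proof.
move=> r0 /convex_functionP ch.
have [->|v0] := eqVneq v 0.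
  by exists 1, (h p); split=> // _ [t _ <-] _; rewrite scaler0 addr0.
have nv0 : 0 < `|v| by rewrite normr_gt0.
set s := r / 2 / `|v|; have s0 : 0 < s by rewrite !divr_gt0.
have ps : ball p r (p + s *: v) /\ ball p r (p - s *: v).
  rewrite -!ball_normE /ball_ /= !opprD !addrA !subrr !sub0r opprK normrN.
  rewrite normrZ gtr0_norm// divfK ?gt_eqF//; split; lra.
exists (r / 2), (`|h (p + s *: v)| + `|h (p - s *: v)|); split; first by lra.
move=> _ [t _ <-]; rewrite normrZ => tr.
have ts : `|t| < s by rewrite ltr_pdivlMr.
have /andP[ts1 ts2] : - s < t < s by rewrite -ltr_norml.
(* The weight that solves [c * s + (1 - c) * - s = t]. *)
pose c := (t / s + 1) / 2.
have cE : c * s *+ 2 = t + s by rewrite /c; field; rewrite gt_eqF.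
have c0 : 0 <= c by nra.
have c1 : c <= 1 by nra.
have := ch c _ _ c0 c1 ps.1 ps.2.
rewrite (_ : c *: _ + _ = p + t *: v); last first.
  rewrite !scalerDr addrACA -scalerDl -(scaleNr s v) !scalerA -scalerDl.
  have -> : c + (1 - c) = 1 by ring.
  rewrite scale1r; congr (_ + _ *: _).
  rewrite (_ : c * s + (1 - c) * - s = c * s *+ 2 - s); last by ring.
  by rewrite cE addrK.
move=> /le_trans; apply; apply: lerD.
  apply: (le_trans (ler_norm _)); rewrite normrM ger0_norm//.
  by rewrite ler_piMl.
apply: (le_trans (ler_norm _)); rewrite normrM ger0_norm ?subr_ge0//.
rewrite ler_piMl//; lra.
Qed.

(* p + (a + b) is the midpoint of p + 2a and p + 2b. *)
Lemma convex_bounded_above_add h p r A B C : 0 < r ->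
  convex_function (ball p r) h ->
  (forall d, A d -> A (2 *: d)) -> (forall d, B d -> B (2 *: d)) ->
  (forall d, C d -> exists a b, [/\ d = a + b, A a, B b,
     `|a| <= `|d| & `|b| <= `|d|]) ->
  bounded_above_near h p A -> bounded_above_near h p B ->
  bounded_above_near h p C.
Proof.
move=> r0 /convex_functionP ch A2 B2 CAB [eA [MA [eA0 hA]]] [eB [MB [eB0 hB]]].
(* The radius is halved because [h] is evaluated at the doubled displacements, which must obey both
   bounds and stay in the ball. *)
exists (Num.min (Num.min eA eB) r / 2), ((MA + MB) / 2); split.
  by rewrite divr_gt0 // !lt_min eA0 eB0.
move=> _ /CAB [a [b [-> Aa Bb na nb]]]; rewrite ltr_pdivlMr// !lt_min mulrC.
move=> /andP[/andP[dA dB] dr].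
have n2 c : `|2 *: c| = 2 * `|c| :> R by move=> *; rewrite normrZ ger0_norm.
have a2 : `|2 *: a| <= 2 * `|a + b| by rewrite n2 ler_wpM2l.
have b2 : `|2 *: b| <= 2 * `|a + b| by rewrite n2 ler_wpM2l.
have in_ball c : `|2 *: c| <= 2 * `|a + b| -> ball p r (p + 2 *: c).
  move=> c2; rewrite -ball_normE /ball_ /= opprD addrA subrr sub0r normrN.
  exact: le_lt_trans dr.
have := ch 2^-1 (p + 2 *: a) (p + 2 *: b).
rewrite (_ : 1 - 2^-1 = 2^-1 :> R); last by field.
rewrite -scalerDr (_ : 2^-1 *: _ = p + (a + b)); last first.
  rewrite addrACA -[2 *: a + _]scalerDr (_ : p + p = 2 *: p).
    by rewrite -scalerDr scalerA mulVf ?scale1r.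
  by rewrite scaler_nat mulr2n.
move=> H; apply: le_trans (H _ _ (in_ball _ a2) (in_ball _ b2)) _; [lra|lra|].
have := hA _ (A2 _ Aa) (le_lt_trans a2 dA).
have := hB _ (B2 _ Bb) (le_lt_trans b2 dB).
lra.
Qed.

End ConvexLocallyLipschitz.

Lemma rV_norm_leP (R : realType) (k : nat) (x : 'rV[R]_k) (e : R) : 0 <= e ->
  `|x| <= e <-> forall i, `|x ord0 i| <= e.
Proof.
move=> e0; rewrite {1}/Num.norm /= mx_normrE; split=> [/bigmax_leP[_ H] i|H].
  exact: (H (ord0, i)).
by apply/bigmax_leP; split=> // -[i j] _ /=; rewrite (ord1 i).
Qed.

(** Induction on the number of coordinates allowed to be nonzero, adding one coordinate line at a
    time. The linear isometry [L] makes the result applicable to each factor of a product. *)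
Lemma convex_bounded_above_rV (R : realType) (V : normedModType R) (k : nat)
    (L : 'rV[R]_k -> V) (h : V -> R) (p : V) (r : R) :
  (forall a b, L (a + b) = L a + L b) -> (forall t a, L (t *: a) = t *: L a) ->
  (forall a, `|L a| = `|a|) -> 0 < r -> convex_function (ball p r) h ->
  bounded_above_near h p [set L d | d in setT].
Proof.
move=> LD LZ Ln r0 ch.
pose A j := [set L d | d in [set d : 'rV[R]_k | forall i : 'I_k,
  (j <= i)%N -> d ord0 i = 0]].
suff : forall j, (j <= k)%N -> bounded_above_near h p (A j).
  move=> /(_ k (leqnn k)) [e [M [e0 hM]]]; exists e, M; split=> // _ [d _ <-].
  by apply: hM; exists d => // i; rewrite leqNgt ltn_ord.
elim=> [_|j IH jk].
  exists 1, (h p); split=> // _ [d d0 <-] _.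
  have -> : d = 0 by apply/rowP => i; rewrite d0// mxE.
  by rewrite -(scale0r (0 : 'rV[R]_k)) LZ scale0r addr0.
pose i0 := Ordinal jk; pose v := L (delta_mx 0 i0).
apply: (convex_bounded_above_add r0 ch) (IH (ltnW jk))
  (convex_bounded_above_line v r0 ch) => [_ [d Ad <-]|_ [t _ <-]|_ [d Ad <-]].
- by exists (2 *: d); rewrite ?LZ// => i ji; rewrite mxE Ad// mulr0.
- by exists (2 * t); rewrite ?scalerA.
(* [d] is split into its first [j] coordinates and its coordinate [i0]; neither part exceeds [d] in
   the max norm. *)
pose a := \row_i (if i == i0 then 0 else d ord0 i).
pose b := d ord0 i0 *: (delta_mx 0 i0 : 'rV[R]_k).
exists (L a), (L b); rewrite !Ln; split.
- rewrite -LD; congr L; apply/rowP => i; rewrite !mxE eqxx /= .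
  by case: eqP => [->|_]; rewrite ?mulr1 ?mulr0 ?add0r ?addr0.
- exists a => // i ji; rewrite mxE; case: eqP => // /eqP ii.
  by apply: Ad; rewrite ltn_neqAle ji andbT eq_sym.
- by exists (d ord0 i0); rewrite // LZ.
- apply/rV_norm_leP => // i; rewrite mxE; case: eqP => _; rewrite ?normr0//.
  exact: (rV_norm_leP d (normr_ge0 d)).1.
- apply/rV_norm_leP => // i; rewrite !mxE eqxx /=.
  by case: eqP => _; rewrite ?mulr1 ?mulr0 ?normr0//; exact: (rV_norm_leP d (normr_ge0 d)).1.
Qed.

(** The upper bounds on the two factors combine into one near [p], and [convex_lipschitz_near]
    applies. Stating this for all small radii allows a common radius for several functions. *)
Lemma convex_locally_lipschitz (R : realType) (n m : nat)
    (D : set ('rV[R]_n * 'rV[R]_m)) (h : 'rV[R]_n * 'rV[R]_m -> R)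
    (p : 'rV[R]_n * 'rV[R]_m) :
  nbhs p D -> convex_function D h ->
  \forall r \near 0^'+, exists k,
    forall y z, ball p r y -> ball p r z -> `|h y - h z| <= k * `|y - z|.
Proof.
move=> /nbhs_ballP [r /= r0 rD] cD.
have ch := convex_functionS rD cD.
pose L1 (a : 'rV[R]_n) : 'rV[R]_n * 'rV[R]_m := (a, 0).
pose L2 (b : 'rV[R]_m) : 'rV[R]_n * 'rV[R]_m := (0, b).
have [e [M [e0 hM]]] : bounded_above_near h p setT.
  apply: (convex_bounded_above_add r0 ch)
    (@convex_bounded_above_rV _ _ _ L1 h p r _ _ _ r0 ch)
    (@convex_bounded_above_rV _ _ _ L2 h p r _ _ _ r0 ch).
  - by move=> _ [a _ <-]; exists (2 *: a) => //; rewrite /L1; congr pair; rewrite scaler0.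
  - by move=> _ [a _ <-]; exists (2 *: a) => //; rewrite /L2; congr pair; rewrite scaler0.
  - move=> [a b] _; exists (L1 a), (L2 b); split.
    + by rewrite /L1 /L2; congr pair; rewrite /= ?addr0 ?add0r.
    + by exists a.
    + by exists b.
    + by rewrite !prod_normE /= normr0 ge_max le_max lexx /= le_max normr_ge0.
    + by rewrite !prod_normE /= normr0 ge_max le_max normr_ge0 /= le_max lexx orbT.
  - by move=> a b; rewrite /L1; congr pair; rewrite addr0.
  - by move=> t a; rewrite /L1; congr pair; rewrite scaler0.
  - by move=> a; rewrite prod_normE /= normr0; apply/max_idPl.
  - by move=> a b; rewrite /L2; congr pair; rewrite addr0.
  - by move=> t a; rewrite /L2; congr pair; rewrite scaler0.
  - by move=> a; rewrite prod_normE /= normr0; apply/max_idPr.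
near=> s.
have s0 : 0 < s by [].
(* The doubled ball must lie where [h] is both bounded above and convex. *)
have ss : s + s <= Num.min e r.
  rewrite -mulr2n -mulr_natr -ler_pdivlMr//; near: s; apply: nbhs_right_le.
  by rewrite divr_gt0// lt_min e0.
move: ss; rewrite le_min => /andP[se sr].
apply: (@convex_lipschitz_near _ _ h p s M) => //.
  by apply: convex_functionS ch; exact: le_ball.
move=> z; rewrite -ball_normE /ball_ /= => pz.
rewrite -[z](subrK p) addrC; apply: hM => //.
by rewrite distrC (lt_le_trans pz).
Unshelve. all: by end_near.
Qed.

(** * Marginal functions *)

(* Convexity of a marginal function.  If the infimum is finite at [p], the
   convexity inequality at [p] on a segment from any [z] through [p] makes it
   finite at [z]. *)
Lemma marginal_convex (R : realType) (V : normedModType R) (W : Type)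
    (D : set V) (F : V -> set W) (phi : V -> W -> R) (q : V -> R) (p : V) :
  open D -> convex_set D -> (forall z, D z -> F z !=set0) ->
  (forall (t : R) y z u w, 0 <= t -> t <= 1 -> D y -> D z -> F y u -> F z w ->
    exists2 w', F (t *: y + (1 - t) *: z) w' &
      phi (t *: y + (1 - t) *: z) w' + q (t *: y + (1 - t) *: z) <=
        t * (phi y u + q y) + (1 - t) * (phi z w + q z)) ->
  D p -> has_lbound [set phi p w | w in F p] ->
  (forall z, D z -> has_lbound [set phi z w | w in F z]) /\
  convex_function D (fun z => inf [set phi z w | w in F z] + q z).
Proof.
move=> D_open D_convex F0 cphi Dp [c lbc].
have lbD z : D z -> has_lbound [set phi z w | w in F z].
  move=> Dz.
  have /nbhs_ballP[e /= e0 eD] : nbhs p D by exact: open_nbhs_nbhs.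
  (* Small enough that [z'], just beyond [p] on the ray from [z], stays within [e] of [p]; the [+ 1]
     covers [z = p]. *)
  pose s := e / 2 / (`|p - z| + 1).
  have pz0 : 0 < `|p - z| + 1 by rewrite ltr_wpDl.
  have s0 : 0 < s by rewrite !divr_gt0.
  pose z' := p + s *: (p - z).
  have Dz' : D z'.
    apply: eD; rewrite -ball_normE /ball_ /= /z' opprD addrA subrr sub0r normrN.
    rewrite normrZ gtr0_norm// /s mulrAC ltr_pdivrMr// ltr_pM//; lra.
  have [w' Fw'] := F0 _ Dz'.
  have s10 : 0 < 1 + s by rewrite addr_gt0.
  pose t := s / (1 + s).
  have t0 : 0 < t by rewrite divr_gt0.
  have t1 : t <= 1 by rewrite ler_pdivrMr// mul1r lerDr.
  have pE : t *: z + (1 - t) *: z' = p.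
    rewrite /z' /t (_ : 1 - _ = 1 / (1 + s)); last by field; rewrite gt_eqF.
    rewrite scalerDr scalerA mul1r (mulrC _ s) addrCA -scalerDr (addrC z) subrK.
    rewrite -scalerDl (_ : _ + _ = 1) ?scale1r//.
    by field; rewrite gt_eqF.
  (* The convexity inequality at [p], solved for [phi z w]. As [w'] is fixed, the bound does not
     depend on [w]. *)
  exists ((c + q p - (1 - t) * (phi z' w' + q z')) / t - q z) => _ [w Fw <-].
  have [w'' Fw'' le1] := cphi t z z' w w' (ltW t0) t1 Dz Dz' Fw Fw'.
  move: le1 Fw''; rewrite pE => le1 Fw''.
  have := lbc _ (ex_intro2 _ _ w'' Fw'' erefl) => le2.
  rewrite lerBlDr ler_pdivrMr//; lra.
split=> //; apply/convex_functionP => t y z t0 t1 Dy Dz.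
have hinf x : D x -> has_inf [set phi x w | w in F x].
  move=> Dx; split; last exact: lbD.
  by have [w Fw] := F0 _ Dx; exists (phi x w), w.
have Dx : D (t *: y + (1 - t) *: z) by apply: (convex_setP _).1.
(* The infima need not be attained, so [u] and [w] are minimizers up to [e]; the errors add up to
   [t * e + (1 - t) * e = e]. *)
apply/ler_addgt0Pr => e e0.
have [_ [u Fu <-] lu] := inf_adherent e0 (hinf _ Dy).
have [_ [w Fw <-] lw] := inf_adherent e0 (hinf _ Dz).
have [w' Fw' le1] := cphi t y z u w t0 t1 Dy Dz Fu Fw.
have le2 : inf [set phi (t *: y + (1 - t) *: z) w0
    | w0 in F (t *: y + (1 - t) *: z)] <= phi (t *: y + (1 - t) *: z) w'.
  by apply: ge_inf; [exact: lbD|exists w'].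
have le3 := ler_wpM2l t0 (ltW lu).
have t10 : 0 <= 1 - t by lra.
have le4 := ler_wpM2l t10 (ltW lw).
lra.
Qed.

(** * Quadratic terms and joint convexity *)

Lemma sqnorm_ge0 (R : realType) (k : nat) (x : 'rV[R]_k) : 0 <= sqnorm x.
Proof. by apply: sumr_ge0 => i _; exact: sqr_ge0. Qed.

Lemma sqnorm_convex (R : realType) (k : nat) (t : R) (x y : 'rV[R]_k) :
  0 <= t -> t <= 1 ->
  sqnorm (t *: x + (1 - t) *: y) <= t * sqnorm x + (1 - t) * sqnorm y.
Proof.
move=> t0 t1; rewrite /sqnorm !big_distrr -big_split; apply: ler_sum => i _ /=.
rewrite !mxE -subr_ge0.
rewrite (_ : _ - _ = t * (1 - t) * (x ord0 i - y ord0 i) ^+ 2); last by ring.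
by rewrite mulr_ge0 ?sqr_ge0// mulr_ge0// subr_ge0.
Qed.

(* The coefficient rho / (1 - rho * gamma) of |y|^2 is the one that completes
   the square in (w, y). *)
Lemma proximal_square (R : realType) (k : nat) (rho gamma : R)
    (w y : 'rV[R]_k) :
  0 < gamma -> rho * gamma < 1 ->
  (2 * gamma)^-1 * sqnorm (w - y) +
    rho / (1 - rho * gamma) / 2 * sqnorm y =
  rho / 2 * sqnorm w +
    (1 - rho * gamma) / (2 * gamma) *
      sqnorm (w - (1 - rho * gamma)^-1 *: y).
Proof.
move=> g0 rg; have g_neq0 := lt0r_neq0 g0.
have c_neq0 : 1 - rho * gamma != 0 by rewrite subr_eq0 gt_eqF.
rewrite /sqnorm !big_distrr -!big_split; apply: eq_bigr => i _ /=.
by rewrite !mxE; field; rewrite c_neq0.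
Qed.

(** By [proximal_square], [phi + q] is [f] plus exactly the quadratic that weak convexity asks for
    in [(x, w)], plus a nonnegative multiple of the squared norm of a linear expression in
    [(w, y)]. *)
Lemma envelope_convex (R : realType) (n m l : nat)
    (Omega : set 'rV[R]_n) (Y : set 'rV[R]_m)
    (f : 'rV[R]_n * 'rV[R]_m -> R) (g : 'rV[R]_n * 'rV[R]_m -> 'rV[R]_l)
    (rho gamma t : R) (y z : 'rV[R]_n * 'rV[R]_m) (u w : 'rV[R]_m)
    (phi := fun (z : 'rV[R]_n * 'rV[R]_m) w =>
       f (z.1, w) + (2 * gamma)^-1 * sqnorm (w - z.2))
    (q := fun z : 'rV[R]_n * 'rV[R]_m => rho / 2 * sqnorm z.1 +
       rho / (1 - rho * gamma) / 2 * sqnorm z.2) :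
  0 < gamma -> rho * gamma < 1 ->
  weakly_convex rho (feasible_graph Omega Y g) f ->
  0 <= t -> t <= 1 -> Omega y.1 -> Omega z.1 ->
  feasible Y g y.1 u -> feasible Y g z.1 w ->
  phi (t *: y + (1 - t) *: z) (t *: u + (1 - t) *: w)
    + q (t *: y + (1 - t) *: z) <=
    t * (phi y u + q y) + (1 - t) * (phi z w + q z).
Proof.
move=> g0 rg /convex_functionP cf t0 t1 Oy Oz [Yu gu] [Yw gw].
pose s := (1 - rho * gamma)^-1.
have E (x : 'rV[R]_n * 'rV[R]_m) v : phi x v + q x =
    (f (x.1, v) + rho / 2 * sqnorm_pair (x.1, v)) +
    (1 - rho * gamma) / (2 * gamma) * sqnorm (v - s *: x.2).
  have := proximal_square v x.2 g0 rg; rewrite /phi /q /sqnorm_pair /= -/s; lra.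
have c0 : 0 <= (1 - rho * gamma) / (2 * gamma).
  by rewrite divr_ge0 ?mulr_ge0 ?subr_ge0 ?ltW.
rewrite !{}E.
have := cf t (y.1, u) (z.1, w) t0 t1 (conj (conj Oy Yu) gu) (conj (conj Oz Yw) gw).
move=> /= le1.
have := ler_wpM2l c0 (sqnorm_convex (u - s *: y.2) (w - s *: z.2) t0 t1).
have -> : t *: (u - s *: y.2) + (1 - t) *: (w - s *: z.2) =
    t *: u + (1 - t) *: w - s *: (t *: y + (1 - t) *: z).2.
  by apply/rowP => i; rewrite !mxE; ring.
move: le1; rewrite /=; lra.
Qed.

Theorem theorem3 (R : realType) (n m l : nat)
    (X Omega : set 'rV[R]_n) (Y : set 'rV[R]_m)
    (f : 'rV[R]_n * 'rV[R]_m -> R) (g : 'rV[R]_n * 'rV[R]_m -> 'rV[R]_l)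
    (rho_f gamma : R)
    (XO : X `<=` Omega)
    (S_neq0 : forall x, X x -> solution_set Y f g x !=set0)
    (Y_closed : closed Y) (Y_convex : convex_set Y)
    (f_convex : forall x, X x -> convex_function Y (fun y => f (x, y)))
    (g_convex : forall x, X x -> forall i : 'I_l,
       convex_function Y (fun y => g (x, y) ord0 i))
    (X_convex : convex_set X)
    (O_open : open Omega) (O_convex : convex_set Omega)
    (g_jconvex : forall i : 'I_l,
       convex_function (Omega `*` Y) (fun z => g z ord0 i))
    (F_neq0 : forall x, Omega x -> feasible Y g x !=set0)
    (rho_gt0 : 0 < rho_f)
    (f_wconvex : weakly_convex rho_f (feasible_graph Omega Y g) f)
    (gamma_gt0 : 0 < gamma) (gamma_lt : gamma < 1 / rho_f) :
  forall p : 'rV[R]_n * 'rV[R]_m, (X `*` Y) p ->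
    lipschitz_around (Omega `*` setT) (v_env Y f g gamma) p.
Proof.
move=> p [Xp _].
have rg : rho_f * gamma < 1 by rewrite mulrC -ltr_pdivlMr.
pose D : set ('rV[R]_n * 'rV[R]_m) := Omega `*` setT.
pose F (z : 'rV[R]_n * 'rV[R]_m) := feasible Y g z.1.
pose phi (z : 'rV[R]_n * 'rV[R]_m) w :=
  f (z.1, w) + (2 * gamma)^-1 * sqnorm (w - z.2).
pose q (z : 'rV[R]_n * 'rV[R]_m) := rho_f / 2 * sqnorm z.1 +
  rho_f / (1 - rho_f * gamma) / 2 * sqnorm z.2.
pose v z := inf [set phi z w | w in F z].
have F0 z : D z -> F z !=set0 by move=> [Oz _]; exact: F_neq0.
have Dp : D p by split=> //; exact: XO.
have D_open : open D.
  rewrite openE => z [Oz _]; exists (Omega, setT) => //.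
  by split; [exact: open_nbhs_nbhs|exact: filterT].
have [lbD cv] : (forall z, D z -> has_lbound [set phi z w | w in F z]) /\
    convex_function D (fun z => v z + q z).
  apply: (@marginal_convex _ _ _ D F phi q p) => //.
  - apply/convex_setP => t x y t0 t1 [Ox _] [Oy _]; split=> //.
    by apply: (convex_setP _).1.
  - move=> t y z u w t0 t1 [Oy _] [Oz _] Fu Fw.
    exists (t *: u + (1 - t) *: w); last exact: envelope_convex f_wconvex _ _ _ _ _ _.
    (* Joint convexity of the constraints makes the combination of feasible points feasible. *)
    case: (Fu) (Fw) => Yu gu [Yw gw]; split.
      by apply: (convex_setP _).1.
    move=> i; have /convex_functionP cg := g_jconvex i.
    apply: le_trans (cg t (y.1, u) (z.1, w) t0 t1 (conj Oy Yu) (conj Oz Yw)) _.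
    have := ler_wpM2l t0 (gu i); have := @ler_wpM2l _ (1 - t) _ _ _ (gw i).
    by rewrite !mulr0 subr_ge0 => /(_ t1); rewrite /=; lra.
  (* Since the proximal term is nonnegative, the minimum of [f (p.1, _)] is a lower bound. *)
  - have [y0 [_ y0_min]] := S_neq0 _ Xp.
    exists (f (p.1, y0)) => _ [w Fw <-]; rewrite /phi ler_wpDr ?y0_min//.
    by rewrite mulr_ge0 ?sqnorm_ge0// invr_ge0 mulr_ge0// ltW.
(* Nonemptiness and the lower bound identify the extended infimum with the real [inf]. *)
have vE z : D z -> v_env Y f g gamma z = (v z)%:E.
  move=> Dz; rewrite /v_env -ereal_inf_EFin; [|exact: lbD|].
    by rewrite image_comp.
  by have [w Fw] := F0 _ Dz; exists (phi z w), w.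
have cq : convex_function setT q.
  apply/convex_functionP => t x y t0 t1 _ _; rewrite /q /=.
  have c1 : 0 <= rho_f / 2 by rewrite divr_ge0// ltW.
  have c2 : 0 <= rho_f / (1 - rho_f * gamma) / 2.
    by rewrite !divr_ge0// ?subr_ge0 ltW.
  have := ler_wpM2l c1 (sqnorm_convex x.1 y.1 t0 t1).
  have := ler_wpM2l c2 (sqnorm_convex x.2 y.2 t0 t1).
  lra.
have nD : nbhs p D by exact: open_nbhs_nbhs.
have lv := convex_locally_lipschitz nD cv.
have lq := convex_locally_lipschitz (@filterT _ (nbhs p) _) cq.
have sD : \forall s \near 0^'+, ball p s `<=` D.
  have /nbhs_ballP[e /= e0 eD] := nD.
  near=> s; apply: subset_trans eD; apply: le_ball; near: s.
  exact: nbhs_right_le.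
near (0 : R)^'+ => s.
have s0 : 0 < s by [].
have sDs : ball p s `<=` D by near: s.
have [k1 vk] : exists k, forall y z, ball p s y -> ball p s z ->
  `|(v y + q y) - (v z + q z)| <= k * `|y - z| by near: s.
have [k2 qk] : exists k, forall y z, ball p s y -> ball p s z ->
  `|q y - q z| <= k * `|y - z|.
  by near: s; exact: lq.
exists (ball p s); split=> //.
- exact: nbhsx_ballx.
- by move=> z /sDs /vE ->.
(* Writing [v] as [(v + q) - q] adds the two constants; the pair [(p, p)] shows that the filter of
   pairs is proper. *)
apply: (@klipschitzW _ _ _ (k1 + k2)).
  by apply: (@globally_properfilter _ _ (p, p)); split; exact: ballxx.
move=> [y z] [/= py pz]; rewrite !vE ?mulrDl/=; try exact: sDs.
rewrite (_ : v y - v z = ((v y + q y) - (v z + q z)) - (q y - q z)); last by ring.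
by apply: le_trans (ler_normB _ _) _; apply: lerD; [exact: vk|exact: qk].
Unshelve. all: by end_near.
Qed.
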